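(* Let $f_{\mathrm{swsr}}^s$ be the solution of the semi-discrete Vlasov-Poisson equations in the symmetrically weighted (SW) square-root formulation, as given in the context. Then the total momentum $\mathcal{P}(t)=\sum_sm^s\int_0^\ell\int_{\mathbb{R}}v\,f_{\mathrm{swsr}}^s(x,v,t)\,\mathrm{d}v\,\mathrm{d}x$ is (in general) not conserved in time; its drift rate is $$\frac{\mathrm{d}\mathcal{P}}{\mathrm{d}t}=-\Delta x\,N_v\,\mathbf{E}(t)^\top\sum_sq^s\alpha^s\,\mathbf{C}_{N_v-1}^s(t)^2.$$
   Context: Finitely many species $s$ have constants $q^s,u^s\in\mathbb{R}$ and $m^s,\alpha^s>0$; $N_v\ge1$ is the number of velocity modes. The spatial domain $[0,\ell]$ is periodic, with a uniform grid $x^{(1)},\dots,x^{(N_x)}$, spacing $\Delta x=\ell/N_x$. Basis: $\psi_n(\xi)=(\sqrt\pi2^nn!)^{-1/2}\mathcal H_n(\xi)e^{-\xi^2/2}$ with physicists' Hermite polynomials $\mathcal H_n$, $\xi^s=(v-u^s)/\alpha^s$. $\mathbf{D}^p\in\mathbb{R}^{N_x\times N_x}$ is the periodic centered finite difference matrix of even order $p$ ($N_x>p$): the circulant matrix $\mathbf{D}^p_{jk}=d^p_{(k-j)\bmod N_x}$ with $d_0^p=0$; for $1\le k\le p/2=:r$, $d_k^p=\frac{1}{\Delta x}\frac{(-1)^{k+1}(r!)^2}{k(r-k)!(r+k)!}$ and $d_{N_x-k}^p=-d_k^p$; all other $d_k^p=0$. Semi-discrete SW square-root system: differentiable functions $\mathbf{C}_n^s(t)\in\mathbb{R}^{N_x}$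 ($0\le n\le N_v-1$; convention $\mathbf C_{-1}^s=\mathbf C_{N_v}^s=0$) and $\mathbf E(t)\in\mathbb{R}^{N_x}$ with $$\frac{\mathrm d\mathbf C_n^s}{\mathrm dt}=-\mathbf D^p\Big(\alpha^s\sqrt{\tfrac n2}\,\mathbf C_{n-1}^s+\alpha^s\sqrt{\tfrac{n+1}2}\,\mathbf C_{n+1}^s+u^s\mathbf C_n^s\Big)+\frac{q^s}{m^s\alpha^s}\mathbf E\odot\Big(\sqrt{\tfrac n2}\,\mathbf C_{n-1}^s-\sqrt{\tfrac{n+1}2}\,\mathbf C_{n+1}^s\Big),$$ $$\mathbf D^p\mathbf E(t)=\sum_sq^s\alpha^s\sum_{n=0}^{N_v-1}\mathbf C_n^s(t)^2,\qquad \mathbf 1^\top\mathbf E(t)=0,$$ where $\odot$ is the entrywise product, $\mathbf C^2=\mathbf C\odot\mathbf C$, and $\mathbf 1$ is the all-ones vector. The solution is $f^s_{\mathrm{swsr}}(x^{(j)},v,t)=\Big(\sum_{n=0}^{N_v-1}(\mathbf C_n^s(t))_j\,\psi_n(\xi^s)\Big)^2$. All integrals over $x$ are evaluated by the periodic trapezoidal rule $\int_0^\ell g\,\mathrm dx:=\Delta x\sum_jg(x^{(j)})$, so $$\mathcal P(t)=\Delta x\sum_sm^s\alpha^s\sum_{n=0}^{N_v-1}\Big(u^s\,\mathbf C_n^{s\top}\mathbf C_n^s+2\alpha^s\sqrt{\tfrac n2}\,\mathbf C_{n-1}^{s\top}\mathbf C_n^s\Big).$$ *)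

(* Defs.v *)
From HB Require Import structures.
From mathcomp Require Import all_boot all_order all_algebra.
From mathcomp Require Import all_classical all_reals all_analysis.

Set Implicit Arguments.
Unset Strict Implicit.
Unset Printing Implicit Defensive.

Import Order.TTheory GRing.Theory Num.Theory.
Import numFieldNormedType.Exports.

Local Open Scope classical_set_scope.
Local Open Scope ring_scope.

Record sw_setup (R : realType) := SWSetup {
  species : finType;
  sp_charge : species -> R;
  sp_mass : species -> R;
  sp_shift : species -> R; (* $u^s$ *)
  sp_scale : species -> R; (* $\alpha^s$ *)
  mass_gt0 : forall s, 0 < sp_mass s;
  scale_gt0 : forall s, 0 < sp_scale s;
  len : R;
  len_gt0 : 0 < len;
  Nv : nat;
  Nv_ge1 : (1 <= Nv)%N;
  Nx : nat;
  fd_order : nat;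
  fd_order_gt0 : (0 < fd_order)%N;
  fd_order_even : ~~ odd fd_order;
  fd_order_lt : (fd_order < Nx)%N
}.

(* Rodrigues' formula for the physicists' Hermite polynomials *)
Definition hermite (R : realType) (n : nat) (x : R) : R :=
  (-1) ^+ n * expR (x ^+ 2) * derive1n n (fun y : R => expR (- y ^+ 2)) x.

Definition sw_basis (R : realType) (n : nat) (xi : R) : R :=
  (Num.sqrt (Num.sqrt pi * 2 ^+ n * n`!%:R))^-1
    * hermite n xi * expR (- xi ^+ 2 / 2).

Definition hadamard (R : realType) (n : nat) (A B : 'cV[R]_n) : 'cV[R]_n :=
  map2_mx *%R A B.

Section SquareRootSystem.
Variables (R : realType) (V : sw_setup R).

Local Notation S := (species V).
Local Notation q := (@sp_charge R V).
Local Notation m := (@sp_mass R V).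
Local Notation u := (@sp_shift R V).
Local Notation alpha := (@sp_scale R V).
Local Notation Nv := (Nv V).
Local Notation Nx := (Nx V).

Definition dx : R := len V / Nx%:R.

Definition fd_stencil (k : nat) : R :=
  let r := (fd_order V)./2 in
  dx^-1 * ((-1) ^+ k.+1 * r`!%:R ^+ 2
           / (k%:R * (r - k)`!%:R * (r + k)`!%:R)).

(* The two nonzero ranges are disjoint because [fd_order V < Nx]. *)
Definition fd_coef (k : nat) : R :=
  let r := (fd_order V)./2 in
  if (1 <= k <= r)%N then fd_stencil k
  else if (1 <= Nx - k <= r)%N then - fd_stencil (Nx - k)
  else 0.

(* [Nx + k - j] does not truncate, so the index is (k - j) mod Nx. *)
Definition fd_matrix : 'M[R]_Nx :=
  \matrix_(j < Nx, k < Nx) fd_coef ((Nx + k - j) %% Nx).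

(* Modes extended to integer indices by C_n = 0 for n outside 0, ..., Nv - 1;
   this covers C_{-1} = C_{Nv} = 0. *)
Definition mode (C : S -> 'I_Nv -> R -> 'cV[R]_Nx) (s : S) (n : int) (t : R) :
    'cV[R]_Nx :=
  if n is Posz k then oapp (fun i => C s i t) 0 (insub k) else 0.

Definition sw_rhs (C : S -> 'I_Nv -> R -> 'cV[R]_Nx) (E : R -> 'cV[R]_Nx)
    (s : S) (n : 'I_Nv) (t : R) : 'cV[R]_Nx :=
  - (fd_matrix *m
      ((alpha s * Num.sqrt (n%:R / 2)) *: mode C s (n%:Z - 1) t
       + (alpha s * Num.sqrt (n.+1%:R / 2)) *: mode C s (n%:Z + 1) t
       + u s *: mode C s n%:Z t))
  + (q s / (m s * alpha s)) *:
      hadamard (E t)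
        (Num.sqrt (n%:R / 2) *: mode C s (n%:Z - 1) t
         - Num.sqrt (n.+1%:R / 2) *: mode C s (n%:Z + 1) t).

Definition sw_solution (I : set R)
    (C : S -> 'I_Nv -> R -> 'cV[R]_Nx) (E : R -> 'cV[R]_Nx) : Prop :=
  forall t : R, I t ->
    [/\ forall (s : S) (n : 'I_Nv), is_derive t 1 (C s n) (sw_rhs C E s n t),
        fd_matrix *m E t
          = \sum_(s : S) (q s * alpha s) *:
              \sum_(n < Nv) hadamard (C s n t) (C s n t)
      & (const_mx 1 : 'cV[R]_Nx)^T *m E t = 0].

(* [f_swsr C s j v t] is the distribution function at the j-th grid point. *)
Definition f_swsr (C : S -> 'I_Nv -> R -> 'cV[R]_Nx) (s : S) (j : 'I_Nx)
    (v t : R) : R :=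
  (\sum_(n < Nv) C s n t j 0 * sw_basis n ((v - u s) / alpha s)) ^+ 2.

Definition trapezoid (g : 'I_Nx -> R) : R := dx * \sum_(j < Nx) g j.

Definition momentum (C : S -> 'I_Nv -> R -> 'cV[R]_Nx) (t : R) : R :=
  \sum_(s : S) m s *
    trapezoid (fun j =>
      \int[@lebesgue_measure R]_(v in [set: R]) (v * f_swsr C s j v t)).

Definition momentum_drift (C : S -> 'I_Nv -> R -> 'cV[R]_Nx)
    (E : R -> 'cV[R]_Nx) (t : R) : R :=
  - (dx * Nv%:R *
     ((E t)^T *m
      \sum_(s : S) (q s * alpha s) *:
        hadamard (mode C s (Nv%:Z - 1) t) (mode C s (Nv%:Z - 1) t)) 0 0).

End SquareRootSystem.

(* Main.v *)
Require Import Defs.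
From HB Require Import structures.
From mathcomp Require Import all_boot all_order all_algebra.
From mathcomp Require Import all_classical all_reals all_analysis.
From mathcomp Require Import measurable_realfun ring lra.
Import Order.TTheory GRing.Theory Num.Theory.
Import numFieldNormedType.Exports.
Local Open Scope classical_set_scope.
Local Open Scope ring_scope.

(** The drift formula rests on three operators acting on coefficient sequences
    [c] of an expansion [g = \sum_n c n * psi_n (xi)]: multiplication by [v]
    ([velocity_coef]), the derivative [- d/dxi] ([neg_deriv_coef]), and the
    difference matrix [D] acting on the grid.  Multiplication by [v] is
    symmetric ([velocity_coef_sym]), [D] is skew ([fd_matrix_skew]).

    Since the basis is orthonormal and [xi * psi_n (xi)] is a combination of
    [psi_(n+1) (xi)] and [psi_(n-1) (xi)], the momentum is the quadratic form
    [dx * \sum_s m * alpha * \sum_j <c, v c>] in the coefficients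
    ([velocity_moment], [momentumE]).  Orthonormality needs only that the
    functional [p |-> \int p(xi) * exp (- xi^2) dv] obeys Gaussian integration by
    parts and has the right value at [1] ([gauss_functional],
    [hermite_poly_orthogonal]).

    By symmetry the derivative of [<c, v c>] is [2 <v c, c'>].  The transport
    part of [c'] is [- D (v c)], and contributes [- 2 <v c, D (v c)> = 0]
    because [D] is skew.  The field part is a multiple of
    [E <v c, - d/dxi c>].  In an infinite expansion the commutator of [d/dxi]
    and [v] would be [alpha], so that [<v c, - d/dxi c>] would be half of
    [alpha * |c|^2]; truncation at [N] modes replaces [|c|^2] by
    [|c|^2 - N * c_(N-1)^2] ([truncated_commutator]).  The [|c|^2] part, summed
    over the species, is the pairing of [E] with the charge density [D E], which
    vanishes by skewness again; the top-mode part is the drift.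

    Momentum really does drift in the following solution.  On four grid points
    with the second-order stencil, every grid function that depends only on the
    parity of the point lies in the kernel of [D].  Hence a constant field
    alternating in sign is compatible with zero charge density, transport
    disappears, and with two modes each coefficient pair just rotates.  Two
    species of opposite charge with suitable phases keep the charge density at
    zero while the momentum is a nonzero multiple of [sin t * cos t]. *)

(** * Integrals of polynomials against a Gaussian *)

Section Gauss.
Context {R : realType}.
Implicit Types (p : {poly R}) (x v u a : R).
Local Notation mu := (@lebesgue_measure R).

(** The exponential series dominates each of its terms: with [y = x^2 / 2], the
    bound [y^(n+1) / (n+1)! <= exp y] handles [`|x| > 1]. *)
Lemma expr_gauss_bounded n : exists2 M : R, 0 <= M &
  forall x, `|x| ^+ n * expR (- x ^+ 2 / 2) <= M.
Proof.
exists (1 + 2 ^+ n.+1 * n.+1`!%:R); first by rewrite addr_ge0 ?mulr_ge0 ?exprn_ge0.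
move=> x; rewrite mulNr expRN ler_pdivrMr ?expR_gt0//.
set y := x ^+ 2 / 2.
have y0 : 0 <= y by rewrite divr_ge0 ?sqr_ge0.
have h := expR_ge1Dxn n y0.
have f0 : (0 : R) < n.+1`!%:R by rewrite ltr0n fact_gt0.
have h1 : 1 <= expR y.
  by apply: le_trans h; rewrite lerDl divr_ge0 ?exprn_ge0// ltW.
have h2 : (`|x| ^+ 2) ^+ n.+1 <= 2 ^+ n.+1 * n.+1`!%:R * expR y.
  have -> : `|x| ^+ 2 = 2 * y by rewrite real_normK ?num_real// /y; field.
  rewrite exprMn -mulrA ler_pM2l ?exprn_gt0// mulrC -ler_pdivrMr//.
  by apply: le_trans h; rewrite lerDr.
rewrite mulrDl mul1r; have [x1|x1] := leP `|x| 1.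
  rewrite (@le_trans _ _ 1) ?exprn_ile1//.
  by rewrite (le_trans h1)// lerDl (le_trans _ h2)// exprn_ge0// sqr_ge0.
rewrite (le_trans _ (le_trans h2 _)) ?lerDr ?expR_ge0//.
by rewrite -exprM ler_weXn2l ?(ltW x1)// mul2n -addnn (leq_trans (leqnSn n)) ?leq_addr.
Qed.

(** Half of the Gaussian absorbs the polynomial; the other half provides an
    integrable dominating function and the decay at infinity. *)
Lemma horner_gauss_bounded p : exists2 M : R, 0 <= M &
  forall x, `|p.[x]| * expR (- x ^+ 2) <= M * expR (- x ^+ 2 / 2).
Proof.
suff [M M0 hM] : exists2 M : R, 0 <= M &
    forall x, `|p.[x]| * expR (- x ^+ 2 / 2) <= M.
  exists M => // x.
  have -> : expR (- x ^+ 2) = expR (- x ^+ 2 / 2) * expR (- x ^+ 2 / 2).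
    by rewrite -expRD; congr expR; field.
  by rewrite mulrA ler_wpM2r ?expR_ge0.
have : forall n, exists2 M : R, 0 <= M &
    forall x, (\sum_(i < n) `|p`_i| * `|x| ^+ i) * expR (- x ^+ 2 / 2) <= M.
  elim=> [|n [M M0 hM]]; first by exists 0 => // x; rewrite big_ord0 mul0r.
  have [M' M'0 hM'] := expr_gauss_bounded n.
  exists (M + `|p`_n| * M'); first by rewrite addr_ge0 ?mulr_ge0.
  move=> x; rewrite big_ord_recr/= mulrDl lerD//.
  by rewrite -mulrA ler_wpM2l.
move=> /(_ (size p)) [M M0 hM]; exists M => // x.
apply: le_trans (hM x); rewrite ler_wpM2r ?expR_ge0// horner_coef.
rewrite (le_trans (ler_norm_sum _ _ _))// ler_sum// => i _.
by rewrite normrM normrX.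
Qed.

(** The shift and scale stay in the integrand, so that the moments of [v] need no
    change of variables. *)
Definition gauss_weighted u a p v : R :=
  p.[(v - u) / a] * expR (- ((v - u) / a) ^+ 2).

Lemma is_derive_horner_gauss p x :
  is_derive x 1 (fun y => p.[y] * expR (- y ^+ 2))
    ((p^`() - 2 *: 'X * p).[x] * expR (- x ^+ 2)).
Proof.
have h : is_derive x 1 (fun y : R => - y ^+ 2) (- (2 * x)).
  apply: is_derive_eq; rewrite /GRing.scale/=; ring.
have h2 : is_derive x 1 (expR \o (fun y : R => - y ^+ 2))
    (expR (- x ^+ 2) * - (2 * x)).
  exact: is_derive1_comp.
apply: (is_derive_eq (is_deriveM (is_derive_poly p x) h2)).
rewrite /GRing.scale/= hornerD hornerN hornerM hornerZ hornerX; ring.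
Qed.

Lemma is_derive_gauss_weighted u a p v :
  is_derive v 1 (gauss_weighted u a p)
    (gauss_weighted u a (p^`() - 2 *: 'X * p) v / a).
Proof.
have h : is_derive v 1 (fun y : R => (y - u) / a) a^-1.
  by apply: is_derive_eq; rewrite /GRing.scale/=; ring.
have h2 := is_derive_horner_gauss p ((v - u) / a).
exact: (@is_derive1_comp _ _ (fun y : R => (y - u) / a) _ _ _ h2 h).
Qed.

Lemma continuous_gauss_weighted u a p : continuous (gauss_weighted u a p).
Proof.
move=> v; apply: differentiable_continuous; apply/derivable1_diffP.
exact: (@ex_derive _ _ _ _ _ _ _ (is_derive_gauss_weighted u a p v)).
Qed.

Lemma integrable_normal_fun u a : a != 0 ->
  mu.-integrable [set: R] (EFin \o normal_fun u a).
Proof.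
move=> a0.
have -> : EFin \o normal_fun u a =
    (fun v => ((normal_peak a)^-1)%:E * (normal_pdf u a v)%:E)%E.
  apply/funext => v /=; rewrite -EFinM normal_pdfE//.
  by rewrite mulKf// gt_eqF// normal_peak_gt0.
by apply: integrableZl => //; exact: integrable_normal_pdf.
Qed.

Lemma normal_funE u a v : normal_fun u a v = expR (- ((v - u) / a) ^+ 2 / 2).
Proof.
by congr expR; rewrite expr_div_n -mulr_natr invfM mulrA mulNr.
Qed.

Lemma measurable_gauss_weighted u a p :
  measurable_fun [set: R] (gauss_weighted u a p).
Proof.
by apply: continuous_measurable_fun; exact: continuous_gauss_weighted.
Qed.

Lemma integrable_gauss_weighted u a p : a != 0 ->
  mu.-integrable [set: R] (EFin \o gauss_weighted u a p).
Proof.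
move=> a0; have [M M0 hM] := horner_gauss_bounded p.
apply: (@le_integrable _ _ _ mu _ measurableT _
  (fun v => M%:E * (normal_fun u a v)%:E)%E).
- by apply/measurable_EFinP; exact: measurable_gauss_weighted.
- move=> v _ /=; rewrite lee_fin [in leLHS]normrM.
  rewrite (ger0_norm (expR_ge0 _)) (le_trans (hM _))//.
  by rewrite -normal_funE ler_norm.
- by apply: integrableZl => //; exact: integrable_normal_fun.
Qed.

(** The integrand is a rescaled density of the normal law with mean [u] and
    standard deviation [a / sqrt 2]. *)
Lemma Rintegral_gauss u a : 0 < a ->
  \int[mu]_v gauss_weighted u a 1 v = a * Num.sqrt pi.
Proof.
move=> a0; pose s := a / Num.sqrt 2.
have s0 : 0 < s by rewrite divr_gt0// sqrtr_gt0.
have s2 : s ^+ 2 *+ 2 = a ^+ 2.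
  by rewrite /s expr_div_n sqr_sqrtr// -mulr_natr divfK.
have pE : normal_peak s = (a * Num.sqrt pi)^-1.
  rewrite /normal_peak -mulrnAl s2 sqrtrM ?sqr_ge0//.
  by rewrite sqrtr_sqr gtr0_norm.
have spi0 : 0 < Num.sqrt pi :> R by rewrite sqrtr_gt0 pi_gt0.
have -> : gauss_weighted u a 1 = (fun v => a * Num.sqrt pi * normal_pdf u s v).
  apply/funext => v; rewrite normal_pdfE ?gt_eqF// pE mulVKf; last first.
    by rewrite mulf_neq0 ?gt_eqF.
  by rewrite /gauss_weighted hornerE mul1r /normal_fun s2 expr_div_n mulNr.
rewrite RintegralZl//; last exact: integrable_normal_pdf.
by rewrite /Rintegral integral_normal_pdf/= mulr1.
Qed.

(** The endpoints [u + e n a] correspond to [xi = e n], where the Gaussian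
    bound is at most [2 M / (n + 1)]. *)
Lemma gauss_weighted_cvg0 u a p (e : R) : a != 0 -> `|e| = 1 ->
  gauss_weighted u a p (u + e * n%:R * a) @[n --> \oo] --> (0 : R).
Proof.
move=> a0 e1; have [M M0 hM] := horner_gauss_bounded p.
apply/norm_cvg0P.
apply: (@squeeze_cvgr _ _ _ _ (fun=> 0) (fun n => 2 * M * harmonic n)).
- apply: nearW => n; rewrite normr_ge0/= /gauss_weighted.
  rewrite (addrC u) addrK mulfK// normrM (ger0_norm (expR_ge0 _)).
  rewrite (le_trans (hM _))// [leLHS]mulrC mulrAC ler_wpM2r//=.
  have e2 : e ^+ 2 = 1 by rewrite -real_normK ?num_real// e1 expr1n.
  rewrite exprMn e2 mul1r mulNr expRN -[leRHS]invrK invfM invrK.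
  rewrite lef_pV2 ?posrE ?expR_gt0 ?mulr_gt0//.
  rewrite (le_trans _ (expR_ge1Dx _))//.
  rewrite -(natr1 n); move: (n%:R : R) => x; have := sqr_ge0 (x - 2^-1); nra.
- exact: cvg_cst.
- by rewrite -[X in _ --> X](mulr0 (2 * M)); apply: cvgMr; exact: cvg_harmonic.
Qed.

Lemma integral_gauss_deriv_itv u a p b c : a != 0 -> b <= c ->
  (\int[mu]_(v in `[b, c]) (gauss_weighted u a (p^`() - 2 *: 'X * p) v)%:E =
    (a * (gauss_weighted u a p c - gauss_weighted u a p b))%:E)%E.
Proof.
move=> a0; rewrite le_eqVlt => /predU1P[<-|bc].
  by rewrite subrr mulr0 set_itv1 integral_set1.
pose F v := a * gauss_weighted u a p v.
have dF v : is_derive v 1 F (gauss_weighted u a (p^`() - 2 *: 'X * p) v).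
  apply: (is_derive_eq (is_deriveZ a (is_derive_gauss_weighted u a p v))).
  by rewrite /GRing.scale/= mulrC divfK.
have cF : continuous F.
  move=> v; apply: differentiable_continuous; apply/derivable1_diffP.
  exact: (@ex_derive _ _ _ _ _ _ _ (dF v)).
rewrite (@continuous_FTC2 _ _ F)//.
- by rewrite -EFinB -mulrBr.
- by apply: continuous_subspaceT; exact: continuous_gauss_weighted.
- split.
  + by move=> v _; exact: (@ex_derive _ _ _ _ _ _ _ (dF v)).
  + by apply: cvg_at_right_filter; exact: cF.
  + by apply: cvg_at_left_filter; exact: cF.
- by move=> v _; rewrite derive1E; exact: (@derive_val _ _ _ _ _ _ _ (dF v)).
Qed.

(** Gaussian integration by parts: the integrand is, up to the factor [a], the
    derivative of a function vanishing at infinity.  The integral over the line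
    is the limit of the integrals over [u - n a, u + n a], by dominated
    convergence. *)
Lemma Rintegral_gauss_deriv u a p : 0 < a ->
  \int[mu]_v gauss_weighted u a (p^`() - 2 *: 'X * p) v = 0.
Proof.
move=> a0; set g := gauss_weighted u a _.
have an0 : a != 0 by rewrite gt_eqF.
pose I n : set R := [set` `[u + -1 * n%:R * a, u + 1 * n%:R * a]].
have ig : mu.-integrable [set: R] (EFin \o g) by exact: integrable_gauss_weighted.
pose F := gauss_weighted u a p.
have mI n : measurable (I n) by exact: measurable_itv.
have mg : measurable_fun [set: R] g by exact: measurable_gauss_weighted.
have hn n : (\int[mu]_x (((g \_ (I n)) x)%:E) =
    (a * (F (u + 1 * n%:R * a) - F (u + -1 * n%:R * a)))%:E)%E.
  rewrite -integral_gauss_deriv_itv//.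
    rewrite [RHS]integral_mkcond; apply: eq_integral => v _.
    by rewrite restrict_EFin.
  by rewrite lerD2l ler_pM2r// mul1r mulN1r ge0_cp.
have [] := @dominated_convergence _ _ _ mu [set: R] measurableT
  (fun n v => ((g \_ (I n)) v)%:E) (EFin \o g) (fun v => `|(g v)%:E|%E).
- move=> n; apply/measurable_EFinP.
  apply/(measurable_restrictT _ (mI n)).
  exact: measurable_funTS.
- by case/integrableP: ig.
- apply: aeW => v _ /=.
  apply: cvg_near_cst.
  near=> n; rewrite patchE mem_set// /I/= in_itv/=.
  have : `|(v - u) / a| <= n%:R by near: n; exact: nbhs_infty_ger.
  rewrite normrM normfV (gtr0_norm a0) ler_pdivrMr// ler_norml.
  by rewrite mul1r mulN1r mulNr lerBlDl lerBrDl.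
- exact: integrable_abse.
- apply: aeW => v n _ /=.
  by rewrite patchE; case: ifPn => // _; rewrite lee_fin normr0.
move=> _ _ h.
have h0 : (fun n => \int[mu]_x (((g \_ (I n)) x)%:E))%E @ \oo --> (0%:E)%E.
  under eq_fun do rewrite hn.
  apply: cvg_EFin; first exact: nearW.
  rewrite /= -(mulr0 a) -[X in a * X](subr0 0); apply: cvgMr.
  apply: cvgB; apply: gauss_weighted_cvg0 => //; first exact: normr1.
  by rewrite normrN normr1.
have := cvg_unique _ h h0.
by rewrite /Rintegral => ->.
Unshelve. all: by end_near. Qed.

(** Everything that the Hermite calculus uses about the Gaussian integral. *)
Lemma gauss_functional u a : 0 < a -> exists L : {scalar {poly R}},
  [/\ forall p, L p = \int[mu]_v gauss_weighted u a p v,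
      forall p, L p^`() = L (2 *: 'X * p)
    & L 1 = a * Num.sqrt pi].
Proof.
move=> a0; have an0 : a != 0 by rewrite gt_eqF.
pose I p := \int[mu]_v gauss_weighted u a p v.
have ig p := integrable_gauss_weighted u a p an0.
have I_lin : scalar I.
  move=> k p q.
  have -> : k * I p = I (k *: p).
    rewrite /I -RintegralZl//; apply: eq_Rintegral => v _.
    by rewrite /gauss_weighted hornerZ mulrA.
  rewrite /I -RintegralD//; apply: eq_Rintegral => v _.
  by rewrite /gauss_weighted hornerD mulrDl.
pose IL := GRing.isLinear.Build R {poly R} R *%R I I_lin.
pose L : {scalar {poly R}} := HB.pack I IL.
exists L; split => //; last exact: Rintegral_gauss.
move=> p; apply/eqP; rewrite -subr_eq0 -raddfB.
by apply/eqP; exact: Rintegral_gauss_deriv.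
Qed.

End Gauss.

(** * Hermite polynomials and the symmetrically weighted basis *)

Section Hermite.
Context {R : realType}.
Implicit Types (p : {poly R}) (x v u a : R).
Local Notation mu := (@lebesgue_measure R).

Fixpoint hermite_poly n : {poly R} :=
  if n is n'.+1 then 2 *: 'X * hermite_poly n' - (hermite_poly n')^`() else 1.

(** Each differentiation of [H_n * exp (- y^2)] produces [- H_(n+1) * exp (- y^2)],
    so Rodrigues' formula and the raising recursion agree. *)
Lemma hermiteE n x : hermite n x = (hermite_poly n).[x].
Proof.
have dE : derive1n n (fun y : R => expR (- y ^+ 2)) =
    (fun y => (-1) ^+ n * ((hermite_poly n).[y] * expR (- y ^+ 2))).
  elim: n => [|n IH].
    by apply/funext => y; rewrite derive1n0 expr0 mul1r hornerC mul1r.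
  apply/funext => y; rewrite derive1nS IH derive1E.
  have h := is_deriveZ ((-1) ^+ n) (is_derive_horner_gauss (hermite_poly n) y).
  rewrite (@derive_val _ _ _ _ _ _ _ h).
  have -> : hermite_poly n.+1 =
    - ((hermite_poly n)^`() - 2 *: 'X * hermite_poly n) by rewrite opprB.
  by rewrite hornerN (exprS _ n) mulN1r !mulNr mulrN opprK.
rewrite /hermite dE mulrACA -exprMn mulrNN mulr1 expr1n mul1r.
by rewrite mulrCA -expRD subrr expR0 mulr1.
Qed.

Lemma deriv_hermite_poly n :
  (hermite_poly n.+1)^`() = (2 * n.+1%:R) *: hermite_poly n.
Proof.
elim: n => [|n IH].
  by rewrite /= mulr1 derivB derivZ derivX derivC deriv0 subr0 mulr1.
have -> : hermite_poly n.+2 =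
  2 *: 'X * hermite_poly n.+1 - (hermite_poly n.+1)^`() by [].
rewrite derivB derivM derivZ derivX IH derivZ -scalerAr -addrA -scalerBr -/(hermite_poly n.+1).
by rewrite -scalerAl mul1r -scalerDl -[in RHS]natr1 mulrDr mulr1 addrC.
Qed.

Lemma hermite_polyX n : 'X * hermite_poly n =
  2^-1 *: hermite_poly n.+1 + n%:R *: hermite_poly n.-1.
Proof.
have two : (2 : R) != 0 by rewrite pnatr_eq0.
have -> : n%:R *: hermite_poly n.-1 = 2^-1 *: (hermite_poly n)^`().
  case: n => [|n]; first by rewrite derivC scaler0 scale0r.
  by rewrite deriv_hermite_poly scalerA mulKf.
by rewrite -scalerDr subrK -scalerAl scalerA mulVf// scale1r.
Qed.

(** Integration by parts moves the raising operator [2 X - d/dX] off the left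
    factor, where it becomes [d/dX] on the right factor; as [d/dX] lowers
    Hermite polynomials, induction reduces both indices together. *)
Lemma hermite_poly_orthogonal (L : {scalar {poly R}}) :
  (forall p, L p^`() = L (2 *: 'X * p)) ->
  forall m n, L (hermite_poly m * hermite_poly n) =
    (2 ^+ n * n`!%:R * L 1) *+ (m == n).
Proof.
move=> ibp.
have lower m p : L (hermite_poly m.+1 * p) = L (hermite_poly m * p^`()).
  rewrite [hermite_poly m.+1]/= mulrBl raddfB/= -mulrA -ibp derivM raddfD/=.
  by rewrite addrC addKr.
elim=> [|m IH] [|n].
- by rewrite mulr1 expr0 fact0 !mul1r.
- by rewrite mulrC lower derivC mulr0 raddf0.
- by rewrite lower derivC mulr0 raddf0.
- rewrite lower deriv_hermite_poly -scalerAr linearZ/= IH eqSS factS natrM exprS.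
  by case: (m == n); rewrite ?mulr1n ?mulr0n ?mulr0//; ring.
Qed.

Definition basis_norm n : R := Num.sqrt (Num.sqrt pi * 2 ^+ n * n`!%:R).

Definition basis_poly n : {poly R} := (basis_norm n)^-1 *: hermite_poly n.

(** The matrix entry [sqrt (n / 2)] of multiplication by [xi] between the modes
    [n - 1] and [n]. *)
Definition ladder n : R := Num.sqrt (n%:R / 2).

Lemma ladder0 : ladder 0 = 0.
Proof. by rewrite /ladder mul0r sqrtr0. Qed.

Lemma sqr_ladder n : ladder n ^+ 2 = n%:R / 2.
Proof. by rewrite sqr_sqrtr ?divr_ge0. Qed.

Lemma ladder_gt0 n : 0 < ladder n.+1.
Proof. by rewrite sqrtr_gt0 divr_gt0. Qed.

Lemma sqrt_pi_gt0 : 0 < Num.sqrt pi :> R.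
Proof. by rewrite sqrtr_gt0 pi_gt0. Qed.

Lemma sqr_basis_norm n : basis_norm n ^+ 2 = Num.sqrt pi * 2 ^+ n * n`!%:R.
Proof. by rewrite sqr_sqrtr// !mulr_ge0 ?exprn_ge0. Qed.

Lemma basis_norm_gt0 n : 0 < basis_norm n.
Proof.
by rewrite sqrtr_gt0 !mulr_gt0 ?exprn_gt0 ?sqrt_pi_gt0// ltr0n fact_gt0.
Qed.

Lemma basis_normS n : basis_norm n.+1 = 2 * ladder n.+1 * basis_norm n.
Proof.
apply/eqP; rewrite -(@eqrXn2 _ 2)//; first last.
- by rewrite !mulr_ge0// ltW// ?basis_norm_gt0// ladder_gt0.
- by rewrite ltW// basis_norm_gt0.
rewrite !exprMn sqr_ladder !sqr_basis_norm exprS factS natrM.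
by apply/eqP; field.
Qed.

Lemma sw_basisE n x :
  sw_basis n x = (basis_poly n).[x] * expR (- x ^+ 2 / 2).
Proof. by rewrite /sw_basis hermiteE hornerZ. Qed.

Lemma basis_polyX n : 'X * basis_poly n =
  ladder n.+1 *: basis_poly n.+1 + ladder n *: basis_poly n.-1.
Proof.
rewrite /basis_poly -scalerAr hermite_polyX scalerDr !scalerA.
have b0 k : basis_norm k != 0 by rewrite gt_eqF// basis_norm_gt0.
have l0 k : ladder k.+1 != 0 by rewrite gt_eqF// ladder_gt0.
congr (_ *: _ + _).
  by rewrite basis_normS; field; rewrite b0 l0.
case: n => [|n]; first by rewrite ladder0 !mul0r mulr0 scale0r.
congr (_ *: _); rewrite /= basis_normS.
have -> : n.+1%:R = 2 * ladder n.+1 ^+ 2 by rewrite sqr_ladder; field.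
by field; rewrite b0 l0.
Qed.

Lemma basis_poly_orthonormal (L : {scalar {poly R}}) :
  (forall p, L p^`() = L (2 *: 'X * p)) ->
  forall m n, L (basis_poly m * basis_poly n) =
    (L 1 / Num.sqrt pi) *+ (m == n).
Proof.
move=> ibp m n; rewrite /basis_poly -scalerAr -scalerAl !linearZ/=.
rewrite hermite_poly_orthogonal//; case: eqP => [->|_]; last by rewrite !mulr0.
rewrite !mulr1n mulrA -invfM -expr2 sqr_basis_norm.
have f0 : n`!%:R != 0 :> R by rewrite pnatr_eq0 -lt0n fact_gt0.
by field; rewrite f0 expf_neq0// gt_eqF// sqrt_pi_gt0.
Qed.

(** The coefficients of [v * g] for [g = \sum_n c n * psi_n (xi)], where
    [v = u + a * xi].  At [n = 0] the truncated [n.-1] is harmless because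
    [ladder 0 = 0]. *)
Definition velocity_coef u a (c : nat -> R) n : R :=
  u * c n + a * (ladder n.+1 * c n.+1 + ladder n * c n.-1).

(** The [N]-th coefficient of [v * g] is lost in the truncation, but pairs with
    [c N = 0]. *)
Lemma velocity_moment u a N (c : nat -> R) : 0 < a -> c N = 0 ->
  \int[mu]_v (v * (\sum_(n < N) c n * sw_basis n ((v - u) / a)) ^+ 2) =
  a * \sum_(n < N) c n * velocity_coef u a c n.
Proof.
move=> a0 cN; have [L [LE ibp L1]] := gauss_functional u a a0.
pose W := \sum_(n < N) c n *: basis_poly n.
transitivity (L ((u%:P + a *: 'X) * (W * W))).
  rewrite LE; apply: eq_Rintegral => v _; rewrite /gauss_weighted.
  set x := (v - u) / a.
  have -> : \sum_(n < N) c n * sw_basis n x = W.[x] * expR (- x ^+ 2 / 2).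
    rewrite /W horner_sum mulr_suml; apply: eq_bigr => n _.
    by rewrite sw_basisE [in RHS]hornerZ mulrA.
  rewrite exprMn hornerM hornerD hornerC hornerZ hornerX hornerM.
  have -> : expR (- x ^+ 2 / 2) ^+ 2 = expR (- x ^+ 2).
    by rewrite expr2 -expRD; congr expR; field.
  have -> : v = u + a * x by rewrite mulrC divfK ?gt_eqF// addrC subrK.
  by rewrite expr2 !mulrA.
have LW k : (k <= N)%N -> L (basis_poly k * W) = a * c k.
  move=> kN; rewrite /W mulr_sumr raddf_sum/=.
  have s0 : Num.sqrt pi != 0 :> R by rewrite gt_eqF// sqrt_pi_gt0.
  under eq_bigr do rewrite -scalerAr linearZ/= basis_poly_orthonormal// L1 mulfK//.
  move: kN; rewrite leq_eqVlt => /predU1P[->|kN].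
    by rewrite cN mulr0 big1// => i _; rewrite gtn_eqF// mulr0n mulr0.
  rewrite (bigD1 (Ordinal kN))//= eqxx mulr1n mulrC big1 ?addr0// => i ik.
  rewrite -val_eqE/= eq_sym in ik.
  by rewrite (negbTE ik) mulr0.
have WE p q : p * (W * q) = \sum_(n < N) c n *: (p * basis_poly n * q).
  rewrite /W mulr_suml mulr_sumr; apply: eq_bigr => n _.
  by rewrite -scalerAl -scalerAr mulrA.
rewrite WE raddf_sum mulr_sumr/=; apply: eq_bigr => n _.
have -> : (u%:P + a *: 'X) * basis_poly n * W = u *: (basis_poly n * W) +
    a *: (ladder n.+1 *: (basis_poly n.+1 * W) +
          ladder n *: (basis_poly n.-1 * W)).
  rewrite mulrDl mul_polyC -scalerAl basis_polyX mulrDl -!scalerAl mulrDl.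
  by rewrite -!scalerAl.
rewrite linearZ/= raddfD/= !linearZ/= raddfD/= !linearZ/=.
rewrite /velocity_coef !LW ?(ltnW (ltn_ord n))//; first ring.
by rewrite (leq_trans (leq_pred n))// ltnW.
Qed.
End Hermite.

(** * Matrix-valued derivatives and the difference matrix *)

Section FiniteDifference.
Context {R : realType}.

Lemma is_derive_mx m n (M : R -> 'M[R]_(m, n)) (dM : 'M[R]_(m, n)) (t : R) :
  is_derive t 1 M dM <-> forall i j, is_derive t 1 (fun x => M x i j) (dM i j).
Proof.
split=> [[dt <-] i j|h].
  split; first exact: (derivable_mxP M t 1).1.
  by rewrite derive_mx// mxE.
have dt : derivable M t 1.
  by apply/derivable_mxP => i j; exact: (@ex_derive _ _ _ _ _ _ _ (h i j)).
split=> //; rewrite derive_mx//; apply/matrixP => i j; rewrite mxE.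
exact: (@derive_val _ _ _ _ _ _ _ (h i j)).
Qed.

Lemma is_derive_bigsum (I : Type) (r : seq I) (h : I -> R -> R) (dh : I -> R) (t : R) :
  (forall i, is_derive t 1 (h i) (dh i)) ->
  is_derive t 1 (fun x => \sum_(i <- r) h i x) (\sum_(i <- r) dh i).
Proof.
move=> hd; elim: r => [|i r IH].
  by under eq_fun do rewrite big_nil; rewrite big_nil; exact: is_derive_cst.
under eq_fun do rewrite big_cons; rewrite big_cons.
exact: is_deriveD.
Qed.

Lemma skew_form_eq0 n (D : 'M[R]_n) (f : 'I_n -> R) :
  D^T = - D -> \sum_j f j * (\sum_k D j k * f k) = 0.
Proof.
move=> /matrixP skew; apply/eqP; rewrite -eqNr -sumrN; apply/eqP.
under eq_bigr do rewrite -mulrN -sumrN mulr_sumr.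
rewrite exchange_big/=; apply: eq_bigr => j _; rewrite mulr_sumr.
apply: eq_bigr => k _; have := skew j k; rewrite !mxE => ->.
by ring.
Qed.

Context (V : sw_setup R).

Lemma fd_coef0 : fd_coef V 0 = 0.
Proof.
rewrite /fd_coef/= subn0; case: ifPn => // /andP[_].
rewrite leqNgt (leq_ltn_trans _ (fd_order_lt V))//.
by rewrite -[X in (_ <= X)%N]odd_double_half -addnn addnA leq_addl.
Qed.

(** The two index ranges of the stencil are exchanged by [i |-> Nx - i], and
    disjoint because twice the half-order is less than [Nx]. *)
Lemma fd_coef_odd i : (0 < i < Nx V)%N -> fd_coef V (Nx V - i) = - fd_coef V i.
Proof.
move=> /andP[i0 iN]; rewrite /fd_coef subKn ?(ltnW iN)// i0 subn_gt0 iN/=.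
have h : (i <= (fd_order V)./2)%N -> (Nx V - i <= (fd_order V)./2)%N = false.
  move=> ir; apply/negbTE; rewrite -ltnNge ltn_subRL.
  rewrite (leq_ltn_trans _ (fd_order_lt V))//.
  rewrite -[X in (_ <= X)%N]odd_double_half -addnn (negbTE (fd_order_even V)).
  by rewrite add0n leq_add2r.
case: ifPn => // ; case: ifPn => //; rewrite ?oppr0 ?opprK//.
by move=> /h ->.
Qed.

Lemma fd_matrix_skew : (fd_matrix V)^T = - fd_matrix V.
Proof.
apply/matrixP => j k; rewrite !mxE.
wlog jk : j k / (j <= k)%N.
  move=> h; have [/ltnW|] := ltnP k j; last exact: h.
  by move=> /h ->; rewrite opprK.
have [<-|jk'] := eqVneq j k.
  by rewrite addnK modnn fd_coef0 oppr0.
have {jk jk'}jk : (j < k)%N by rewrite ltn_neqAle jk andbT.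
have -> : ((Nx V + k - j) %% Nx V)%N = (k - j)%N.
  rewrite -addnBA ?(ltnW jk)// modnDl modn_small//.
  by rewrite (leq_ltn_trans (leq_subr _ _)).
have -> : ((Nx V + j - k) %% Nx V)%N = (Nx V - (k - j))%N.
  rewrite modn_small; first by rewrite subnBA// ltnW.
  by rewrite ltn_subLR ?(leq_trans (ltnW (ltn_ord k)) (leq_addr _ _))// addnC ltn_add2r.
apply: fd_coef_odd.
by rewrite subn_gt0 jk (leq_ltn_trans (leq_subr _ _)).
Qed.

End FiniteDifference.

(** * Coefficient operators on truncated expansions *)

Section Ladder.
Context {R : realType}.
Implicit Types (b c : nat -> R) (u a : R).
Local Notation ladder := (@ladder R).

(** The coefficients of [- dg/dxi]. *)
Definition neg_deriv_coef c n : R := ladder n * c n.-1 - ladder n.+1 * c n.+1.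

Lemma ladder_shift N b c : c N = 0 ->
  \sum_(n < N) b n * (ladder n.+1 * c n.+1) =
  \sum_(n < N) ladder n * b n.-1 * c n.
Proof.
move=> cN; transitivity (\sum_(n < N.+1) ladder n * b n.-1 * c n).
  rewrite big_ord_recl ladder0 !mul0r add0r; apply: eq_bigr => n _.
  by rewrite lift0/=; ring.
by rewrite big_ord_recr/= cN mulr0 addr0.
Qed.

Lemma velocity_coef_sym u a N b c : b N = 0 -> c N = 0 ->
  \sum_(n < N) b n * velocity_coef u a c n =
  \sum_(n < N) velocity_coef u a b n * c n.
Proof.
move=> bN cN.
transitivity (\sum_(n < N) u * (b n * c n) +
    a * (\sum_(n < N) b n * (ladder n.+1 * c n.+1) +
         \sum_(n < N) ladder n * c n.-1 * b n)).
  rewrite -big_split mulr_sumr -big_split; apply: eq_bigr => n _ /=.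
  by rewrite /velocity_coef; ring.
rewrite ladder_shift// -(ladder_shift N c b bN).
rewrite -big_split mulr_sumr -big_split; apply: eq_bigr => n _ /=.
by rewrite /velocity_coef; ring.
Qed.

(** The pairing with [u * c] vanishes because [- d/dxi] is skew.  The pairing with
    [a * xi * g] is a difference of squares
    [(n/2) c_(n-1)^2 - ((n+1)/2) c_(n+1)^2]; shifting the indices telescopes
    it, and the shift of the first square leaves the top-mode term behind. *)
Lemma truncated_commutator u a N c : c N = 0 ->
  2 * (\sum_(n < N) velocity_coef u a c n * neg_deriv_coef c n) =
  a * (\sum_(n < N) c n ^+ 2 - N%:R * c N.-1 ^+ 2).
Proof.
move=> cN.
have down : \sum_(n < N) n%:R * c n.-1 ^+ 2 + N%:R * c N.-1 ^+ 2 =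
    \sum_(n < N) n.+1%:R * c n ^+ 2.
  transitivity (\sum_(n < N.+1) n%:R * c n.-1 ^+ 2); first by rewrite big_ord_recr.
  by rewrite big_ord_recl mul0r add0r; apply: eq_bigr => n _; rewrite lift0.
have up : \sum_(n < N) n.+1%:R * c n.+1 ^+ 2 = \sum_(n < N) n%:R * c n ^+ 2.
  transitivity (\sum_(n < N.+1) n%:R * c n ^+ 2).
    by rewrite big_ord_recl mul0r add0r; apply: eq_bigr => n _; rewrite lift0.
  by rewrite big_ord_recr/= cN expr0n mulr0 addr0.
transitivity (2 * u * (\sum_(n < N) ladder n * c n.-1 * c n -
      \sum_(n < N) c n * (ladder n.+1 * c n.+1)) +
    a * (\sum_(n < N) n%:R * c n.-1 ^+ 2 -
         \sum_(n < N) n.+1%:R * c n.+1 ^+ 2)).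
  rewrite -!sumrB !mulr_sumr -big_split; apply: eq_bigr => n _ /=.
  (* Turn the integer weights into squares of ladder coefficients. *)
  have l k : k%:R = 2 * ladder k ^+ 2 by rewrite sqr_ladder; field.
  by rewrite (l n) (l n.+1) /velocity_coef /neg_deriv_coef; ring.
rewrite ladder_shift// subrr mulr0 add0r up; congr (a * _).
rewrite -(addrK (N%:R * c N.-1 ^+ 2) (\sum_(n < N) n%:R * c n.-1 ^+ 2)) down.
rewrite addrAC -sumrB; congr (_ - _); apply: eq_bigr => n _.
by rewrite -natr1; ring.
Qed.

Lemma is_derive_quadratic u a N (c : R -> nat -> R) (dc : nat -> R) (t : R) :
  (forall n, is_derive t 1 (c ^~ n) (dc n)) -> c t N = 0 -> dc N = 0 ->
  is_derive t 1 (fun x => \sum_(n < N) c x n * velocity_coef u a (c x) n)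
    (2 * \sum_(n < N) velocity_coef u a (c t) n * dc n).
Proof.
move=> hc cN dcN.
have -> : 2 * (\sum_(n < N) velocity_coef u a (c t) n * dc n) =
    \sum_(n < N) (c t n * velocity_coef u a dc n +
                  velocity_coef u a (c t) n * dc n).
  by rewrite big_split/= velocity_coef_sym// mulr_natl mulr2n.
apply: is_derive_bigsum => n.
have hv : is_derive t 1 (fun x => velocity_coef u a (c x) n)
    (velocity_coef u a dc n).
  exact: is_deriveD.
exact: (is_deriveM (hc n) hv).
Qed.

End Ladder.

(** * The drift of the momentum *)

Section Drift.
Context {R : realType}.
Context (V : sw_setup R).
Local Notation S := (species V).
Local Notation q := (@sp_charge R V).
Local Notation m := (@sp_mass R V).
Local Notation u := (@sp_shift R V).
Local Notation alpha := (@sp_scale R V).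
Local Notation Nv := (Nv V).
Local Notation Nx := (Nx V).
Context (C : S -> 'I_Nv -> R -> 'cV[R]_Nx) (E : R -> 'cV[R]_Nx).

(** The zero extension [C_n = 0] for [n >= Nv] gives every mode an unbounded
    index, as the coefficient operators require. *)
Definition mode_coef s (j : 'I_Nx) (t : R) (n : nat) : R := mode C s n%:Z t j 0.

Lemma mode_ord s (n : 'I_Nv) t : mode C s n%:Z t = C s n t.
Proof. by rewrite /mode valK. Qed.

Lemma mode_coef_ord s j t (n : 'I_Nv) : mode_coef s j t n = C s n t j 0.
Proof. by rewrite /mode_coef mode_ord. Qed.

Lemma mode_coef_Nv s j t : mode_coef s j t Nv = 0.
Proof. by rewrite /mode_coef /mode insubF ?ltnn//= mxE. Qed.

Lemma momentumE t : momentum C t = dx V * \sum_s m s * alpha s *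
  \sum_j \sum_(n < Nv) mode_coef s j t n * velocity_coef (u s) (alpha s) (mode_coef s j t) n.
Proof.
rewrite /momentum mulr_sumr; apply: eq_bigr => s _.
rewrite /trapezoid mulrCA; congr (_ * _); rewrite -mulrA; congr (_ * _).
rewrite mulr_sumr.
apply: eq_bigr => j _.
rewrite -velocity_moment ?scale_gt0 ?mode_coef_Nv//; apply: eq_Rintegral => v _.
rewrite /f_swsr; congr (_ * _ ^+ 2); apply: eq_bigr => n _.
by rewrite mode_coef_ord.
Qed.

Lemma mode_pred s (n : nat) t j :
  ladder n * mode C s (n%:Z - 1) t j 0 = ladder n * mode_coef s j t n.-1.
Proof.
case: n => [|n]; first by rewrite ladder0 !mul0r.
by rewrite -[n.+1]addn1 PoszD addrK addn1.
Qed.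

Lemma mode_succ s (n : nat) t j :
  mode C s (n%:Z + 1) t j 0 = mode_coef s j t n.+1.
Proof. by rewrite -PoszD addn1. Qed.

Definition mode_coef_rate s (j : 'I_Nx) (t : R) (n : nat) : R :=
  - (\sum_k fd_matrix V j k * velocity_coef (u s) (alpha s) (mode_coef s k t) n) +
  q s / (m s * alpha s) * E t j 0 * neg_deriv_coef (mode_coef s j t) n.

Lemma sw_rhsE s (n : 'I_Nv) t j : sw_rhs C E s n t j 0 = mode_coef_rate s j t n.
Proof.
rewrite /sw_rhs /mode_coef_rate !mxE; congr (- _ + _).
  apply: eq_bigr => k _; rewrite !mxE -!/(ladder _) -mulrA mode_pred.
  rewrite mode_succ -/(mode_coef s k t n); congr (_ * _).
  by rewrite /velocity_coef; ring.
rewrite -!/(ladder _) mode_pred mode_succ.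
by rewrite -!mulrA.
Qed.

Lemma is_derive_mode_coef (t : R) s j n :
  (forall n' : 'I_Nv, is_derive t 1 (C s n') (sw_rhs C E s n' t)) ->
  is_derive t 1 (fun x => mode_coef s j x n)
    (if (n < Nv)%N then mode_coef_rate s j t n else 0).
Proof.
move=> dC; case: ltnP => hn.
  have := (is_derive_mx _ _ _ _ _).1 (dC (Ordinal hn)) j 0.
  rewrite sw_rhsE/=; congr (is_derive _ _ _ _); apply/funext => x.
  by rewrite -mode_coef_ord.
have -> : (fun x => mode_coef s j x n) = cst 0.
  by apply/funext => x; rewrite /mode_coef /mode insubF ?ltnNge ?hn//= mxE.
exact: is_derive_cst.
Qed.

Lemma is_derive_momentum (t : R) :
  (forall s (n : 'I_Nv), is_derive t 1 (C s n) (sw_rhs C E s n t)) ->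
  fd_matrix V *m E t = \sum_(s : S) (q s * alpha s) *:
    \sum_(n < Nv) hadamard (C s n t) (C s n t) ->
  is_derive t 1 (momentum C) (momentum_drift C E t).
Proof.
move=> dC poisson.
pose N2 s j := \sum_(n < Nv) mode_coef s j t n ^+ 2.
have gauss j : \sum_k fd_matrix V j k * E t k 0 =
    \sum_s q s * alpha s * N2 s j.
  have /matrixP/(_ j 0) := poisson; rewrite mxE => ->.
  rewrite summxE; apply: eq_bigr => s _; rewrite mxE summxE; congr (_ * _).
  by apply: eq_bigr => n _; rewrite mxE -!mode_coef_ord.
(* The field exerts no total force on the charge that generates it. *)
have self : \sum_j E t j 0 * (\sum_s q s * alpha s * N2 s j) = 0.
  under eq_bigr do rewrite -gauss.
  exact: (skew_form_eq0 _ _ (fun j => E t j 0) (fd_matrix_skew V)).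
have -> : momentum_drift C E t = dx V * \sum_s m s * alpha s *
    \sum_j 2 * \sum_(n < Nv) velocity_coef (u s) (alpha s) (mode_coef s j t) n *
       (if (n < Nv)%N then mode_coef_rate s j t n else 0).
  transitivity (dx V * \sum_s q s * alpha s * \sum_j E t j 0 *
      (N2 s j - Nv%:R * mode_coef s j t Nv.-1 ^+ 2)).
    (* [self] accounts for the part proportional to [N2]. *)
    rewrite /momentum_drift -mulrA -mulrN; congr (_ * _).
    rewrite -[LHS](add0r (- _)) -[X in X + _ = _]self mxE mulr_sumr -sumrB.
    under [RHS]eq_bigr do rewrite mulr_sumr.
    rewrite exchange_big/=; apply: eq_bigr => j _.
    rewrite mxE summxE !mulr_sumr -sumrB; apply: eq_bigr => s _.
    rewrite !mxE -(prednK (Nv_ge1 V)) -[Nv.-1.+1]addn1 PoszD addrK addn1/=.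
    by rewrite prednK ?Nv_ge1// -/(mode_coef s j t Nv.-1); ring.
  congr (_ * _); apply: eq_bigr => s _.
  have m0 : m s != 0 by rewrite gt_eqF ?mass_gt0.
  have a0 : alpha s != 0 by rewrite gt_eqF ?scale_gt0.
  transitivity (m s * alpha s * (\sum_j 2 * \sum_(n < Nv)
     velocity_coef (u s) (alpha s) (mode_coef s j t) n *
       (q s / (m s * alpha s) * E t j 0 * neg_deriv_coef (mode_coef s j t) n))).
    rewrite !mulr_sumr; apply: eq_bigr => j _.
    transitivity (m s * alpha s * (q s / (m s * alpha s) * E t j 0 *
      (2 * \sum_(n < Nv) velocity_coef (u s) (alpha s) (mode_coef s j t) n *
         neg_deriv_coef (mode_coef s j t) n))).
      rewrite truncated_commutator ?mode_coef_Nv// /N2.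
      by field; rewrite m0 a0.
    congr (_ * _); rewrite mulrCA; congr (_ * _); rewrite mulr_sumr.
    by apply: eq_bigr => n _; ring.
  congr (_ * _); rewrite -!mulr_sumr; congr (_ * _).
  (* The two sides differ by the transport term, a skew form for each mode. *)
  apply/eqP; rewrite eq_sym -subr_eq0 -sumrB; apply/eqP.
  under eq_bigr do rewrite -sumrB.
  rewrite exchange_big/=; apply: big1 => n _.
  have := skew_form_eq0 _ _ (fun j =>
    velocity_coef (u s) (alpha s) (mode_coef s j t) n) (fd_matrix_skew V).
  move=> /(congr1 (@GRing.opp R)); rewrite oppr0 -sumrN => skew; apply: etrans skew.
  by apply: eq_bigr => j _; rewrite ltn_ord /mode_coef_rate; ring.
have -> : momentum C = fun x => dx V * \sum_s m s * alpha s *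
    \sum_j \sum_(n < Nv) mode_coef s j x n *
      velocity_coef (u s) (alpha s) (mode_coef s j x) n.
  by apply/funext => x; exact: momentumE.
apply: is_deriveZ; apply: is_derive_bigsum => s; apply: is_deriveZ.
apply: is_derive_bigsum => j.
apply: (is_derive_quadratic (u s) (alpha s) Nv (fun x => mode_coef s j x)
  (fun n => if (n < Nv)%N then mode_coef_rate s j t n else 0)).
- by move=> n; exact: is_derive_mode_coef.
- exact: mode_coef_Nv.
- by rewrite ltnn.
Qed.

End Drift.

(** * A solution whose momentum is not conserved *)

Section Example.
Context {R : realType}.

Definition bool_sign (b : bool) : R := if b then 1 else -1.

Definition ex_setup : sw_setup R := {|
  species := bool; sp_charge := bool_sign; sp_mass := fun=> 1; sp_shift := fun=> 0;
  sp_scale := fun=> 1; mass_gt0 := fun=> ltr01; scale_gt0 := fun=> ltr01;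
  len := 4; len_gt0 := ltr0Sn R 3; Nv := 2; Nv_ge1 := isT; Nx := 4;
  fd_order := 2; fd_order_gt0 := isT; fd_order_even := isT; fd_order_lt := isT |}.

(** The field turns the coefficient pair at angular speed [1], in the direction
    given by the product of the charge sign and the sign of the field, which is
    positive when [s (+) odd j].  The phases are such that the product of the
    two coefficients is [sin t * cos t] for both directions. *)
Definition ex_mode (s : bool) (n : 'I_2) (t : R) : 'cV[R]_4 :=
  \col_(j < 4) (if s (+) odd j (+) odd n then cos t else sin t).

(** The amplitude cancels the coupling [ladder 1 = 1 / sqrt 2]. *)
Definition ex_field (t : R) : 'cV[R]_4 := \col_(j < 4) (Num.sqrt 2 * bool_sign (~~ odd j)).

(** With four points and the second-order stencil, row [j] compares the two
    neighbours of [j], which have the same parity. *)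
Lemma ex_fd_parity (f : bool -> R) (j : 'I_4) :
  \sum_(k < 4) fd_matrix ex_setup j k * f (odd k) = 0.
Proof.
have c3 : fd_coef ex_setup 3 = - fd_coef ex_setup 1 by [].
have c2 : fd_coef ex_setup 2 = 0 by [].
have c0 : fd_coef ex_setup 0 = 0 by [].
rewrite !big_ord_recl big_ord0 !mxE.
case: j => -[|[|[|[|//]]]] hj; rewrite !lift0 /= ?c3 ?c2 ?c0; ring.
Qed.

Lemma ex_mode_coefE s (j : 'I_4) t n : mode_coef ex_setup ex_mode s j t n =
  if (n < 2)%N then if s (+) odd j (+) odd n then cos t else sin t else 0.
Proof.
case: ltnP => hn; last first.
  by rewrite /mode_coef /mode insubF ?mxE//= ltnNge hn.
by have /= -> := @mode_coef_ord _ ex_setup ex_mode s j t (Ordinal hn); rewrite mxE.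
Qed.

Lemma ex_solution : sw_solution (V:=ex_setup) [set: R] ex_mode ex_field.
Proof.
move=> t _; split.
- move=> s n; apply/is_derive_mx => j k; rewrite ord1 sw_rhsE /mode_coef_rate.
  pose g b i : R := if (i < 2)%N then if s (+) b (+) odd i then cos t else sin t else 0.
  have -> : \sum_(k < 4) fd_matrix ex_setup j k *
      velocity_coef 0 1 (mode_coef ex_setup ex_mode s k t) n = 0.
    rewrite -[RHS](ex_fd_parity (fun b => velocity_coef 0 1 (g b) n) j).
    apply: eq_bigr => i _; congr (_ * _).
    by rewrite /velocity_coef !ex_mode_coefE.
  rewrite oppr0 add0r /neg_deriv_coef !ex_mode_coefE mxE /=.
  have -> : (fun x => ex_mode s n x j 0) =
      if s (+) odd j (+) odd n then cos else sin.
    by apply/funext => x; rewrite mxE; case: ifP.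
  have l1 : ladder 1 = (Num.sqrt 2)^-1 :> R by rewrite /ladder div1r sqrtrV.
  have r2 : Num.sqrt 2 != 0 :> R by rewrite gt_eqF// sqrtr_gt0.
  case: s g => g; case: (odd j); case: n {g} => -[|[|//]] hn /=;
    rewrite ?ladder0 ?l1 /bool_sign /=; apply: is_derive_eq; field; exact: r2.
- apply/matrixP => j k; rewrite mxE.
  transitivity (0 : R).
    rewrite -[RHS](ex_fd_parity (fun b => Num.sqrt 2 * bool_sign (~~ b)) j).
    by apply: eq_bigr => i _; congr (_ * _); rewrite mxE.
  rewrite big_bool /= !big_ord_recl !big_ord0 !mxE /=.
  by case: (odd j); rewrite /=; ring.
- apply/matrixP => i k; rewrite !mxE !big_ord_recl big_ord0 !mxE /bool_sign /=.
  by ring.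
Qed.

Lemma ex_momentum t : momentum (V:=ex_setup) ex_mode t =
  16 * dx ex_setup * ladder 1 * (sin t * cos t).
Proof.
rewrite momentumE !big_bool/=.
rewrite !big_ord_recl !big_ord0 /velocity_coef !ex_mode_coefE/= /bump/= ladder0.
by ring.
Qed.

Lemma ex_not_conserved : momentum (V:=ex_setup) ex_mode 0 <> momentum (V:=ex_setup) ex_mode 1.
Proof.
rewrite !ex_momentum sin0 mul0r mulr0 => /eqP; rewrite eq_sym gt_eqF//.
rewrite !mulr_gt0 ?ladder_gt0 ?cos1_gt0//.
  by rewrite invr_gt0 ltr0n.
by rewrite sin_gt0_pi// ltr01/= (lt_le_trans _ (pi_ge2 R))// ltr1n.
Qed.

End Example.

Theorem theorem8 (R : realType) :
  (forall (V : sw_setup R) (I : set R)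
      (C : species V -> 'I_(Nv V) -> R -> 'cV[R]_(Nx V))
      (E : R -> 'cV[R]_(Nx V)),
      open I -> sw_solution I C E ->
      forall t : R, I t ->
        is_derive t 1 (momentum C) (momentum_drift C E t))
  /\
  (exists (V : sw_setup R)
      (C : species V -> 'I_(Nv V) -> R -> 'cV[R]_(Nx V))
      (E : R -> 'cV[R]_(Nx V)),
      sw_solution [set: R] C E /\
      exists t1 t2 : R, momentum C t1 <> momentum C t2).
Proof.
split.
  move=> V I C E _ sol t It; have [dC poisson _] := sol t It.
  exact: is_derive_momentum.
exists ex_setup, ex_mode, ex_field; split; first exact: ex_solution.
by exists 0, 1; exact: ex_not_conserved.
Qed.
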